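(* Let $\Phi=(\phi_n)$ and $\Psi=(\psi_n)$ be Gabor systems (or wavelet systems) in $\mathcal H=L^2(\mathbb R)$ with nonzero generators, and let $m=(m_n)$ be a complex scalar sequence that is NBB. If $M_{m,\Phi,\Psi}$ is unconditionally convergent and invertible, then there exist scalar sequences $(c_n)$ and $(d_n)$ with $m_n=c_n\overline{d_n}$ for every $n$ such that $(c_n\phi_n)$ and $(d_n\psi_n)$ are frames for $\mathcal H$.
   Context: A Gabor system in $L^2(\mathbb R)$ with generator $g\in L^2(\mathbb R)$ is a family $\{e^{2\pi i lbx}g(x-ka)\}_{k,l\in\mathbb Z}$ with $a,b>0$; a wavelet system with generator $g\in L^2(\mathbb R)$ is a family $\{a^{j/2}g(a^jx-kb)\}_{j,k\in\mathbb Z}$ with $a>1$, $b>0$. Each is enumerated as a sequence indexed by $\mathbb N$. The multiplier is $M_{m,\Phi,\Psi}f=\sum_{n=1}^\infty m_n\langle f,\psi_n\rangle\phi_n$, where $\langle\cdot,\cdot\rangle$ is linear in the first argument. It is unconditionally convergent if for every $f\in\mathcal H$ the series converges unconditionally (i.e. it converges for every permutation of its terms). It is invertible if the resulting linear operator $M:\mathcal H\to\mathcal H$ has a bounded operator $M^{-1}:\mathcal H\to\mathcal H$ with $MM^{-1}=M^{-1}M=I_{\mathcal H}$. A scalar sequence $m$ is NBB (norm-bounded below) if $\inf_n|m_n|>0$. A sequence $(\phi_n)$ in $\mathcal H$ is a frame for $\mathcal H$ if there are constants $0<A\le B<\infty$ with $A\|h\|^2\le\sum_n|\langle h,\phi_n\rangle|^2\le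 B\|h\|^2$ for all $h\in\mathcal H$. *)

(* Defs.v *)
From HB Require Import structures.
From mathcomp Require Import all_boot all_order all_algebra.
From mathcomp Require Import generic_quotient ring_quotient complex.
From mathcomp Require Import all_classical all_reals all_analysis.
From mathcomp Require Import measurable_realfun.

Set Implicit Arguments.
Unset Strict Implicit.
Unset Printing Implicit Defensive.

Import Order.TTheory GRing.Theory Num.Theory.
Import numFieldNormedType.Exports.
Import Normc.

Local Open Scope classical_set_scope.
Local Open Scope ring_scope.
Local Open Scope complex_scope.
Local Open Scope quotient_scope.

Section SquareIntegrable.
Context {R : realType}.
Implicit Types (f g : R -> R[i]) (z : R[i]).
Local Notation mu := (@lebesgue_measure R).

(* normc is the R-valued modulus; `|z| on R[i] is R[i]-valued. *)
Definition sqint : {pred (R -> R[i])} := mem [set f : R -> R[i] |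
  [/\ measurable_fun [set: R] (fun x => complex.Re (f x)),
      measurable_fun [set: R] (fun x => complex.Im (f x)) &
      finite_norm mu 2%:E (fun x => normc (f x))]].

Lemma normcE z : normc z = Num.sqrt (complex.Re z ^+ 2 + complex.Im z ^+ 2).
Proof. by case: z. Qed.

Lemma normc_ge0 z : 0 <= normc z.
Proof. by rewrite normcE sqrtr_ge0. Qed.

Lemma measurable_normc f :
  measurable_fun [set: R] (fun x => complex.Re (f x)) ->
  measurable_fun [set: R] (fun x => complex.Im (f x)) ->
  measurable_fun [set: R] (fun x => normc (f x)).
Proof.
move=> mr mi; under eq_fun do rewrite normcE.
have msq : measurable_fun [set: R] (@Num.sqrt R).
  exact: (continuous_measurable_fun (@sqrt_continuous R)).
apply: (measurableT_comp msq).
by apply: measurable_funD; exact: measurable_funX.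
Qed.

Lemma sqint_Lfun f : f \in sqint -> (fun x => normc (f x)) \in Lfun mu 2%:E.
Proof.
rewrite inE => -[mr mi fi]; apply/andP; split; rewrite inE//=.
exact: measurable_normc.
Qed.

Lemma le_Lnorm2 (u v : R -> R) :
  measurable_fun [set: R] u -> measurable_fun [set: R] v ->
  {ae mu, forall x, `|u x| <= `|v x|} ->
  ('N[mu]_2%:E[EFin \o u] <= 'N[mu]_2%:E[EFin \o v])%E.
Proof.
move=> mu_ mv uv; rewrite unlock /Lnorm.
have mp (w : R -> R) : measurable_fun [set: R] w ->
    measurable_fun [set: R] (fun x => `|(EFin \o w) x| `^ 2)%E.
  move=> mw; apply: (measurableT_comp (measurable_poweR 2)).
  apply: measurableT_comp => //.
  exact/measurable_EFinP.
apply: gt0_ler_poweR; first by rewrite invr_ge0.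
- by rewrite in_itv/= leey andbT integral_ge0// => x _; exact: poweR_ge0.
- by rewrite in_itv/= leey andbT integral_ge0// => x _; exact: poweR_ge0.
apply: ae_ge0_le_integral => //; [|exact: mp| |exact: mp|].
- by move=> x _; exact: poweR_ge0.
- by move=> x _; exact: poweR_ge0.
apply: (@filterS _ _ (ae_filter_ringOfSetsType mu)) uv => x uvx _.
rewrite /= lee_fin.
by apply: ge0_ler_powR; rewrite ?nnegrE ?normr_ge0.
Qed.

Lemma ReZ a z : complex.Re (a *: z) =
  complex.Re a * complex.Re z - complex.Im a * complex.Im z.
Proof. by case: a z => [? ?] [? ?]. Qed.

Lemma ImZ a z : complex.Im (a *: z) =
  complex.Re a * complex.Im z + complex.Im a * complex.Re z.
Proof. by case: a z => [? ?] [? ?]. Qed.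

Lemma ReD y z : complex.Re (y + z) = complex.Re y + complex.Re z.
Proof. by case: y z => [? ?] [? ?]. Qed.

Lemma ImD y z : complex.Im (y + z) = complex.Im y + complex.Im z.
Proof. by case: y z => [? ?] [? ?]. Qed.

Lemma sqint_submod_closed : submod_closed sqint.
Proof.
split.
  rewrite inE; split; [exact: measurable_cst|exact: measurable_cst|].
  rewrite /finite_norm (_ : _ \o _ = cst 0%E) ?Lnorm0//.
  by apply/funext => x; congr EFin; exact: normc0.
move=> a f g sf sg.
have p1 : (1 <= 2%:E :> \bar R)%E by rewrite lee_fin ler1n.
have := (Lfun_submod_closed mu p1).2 (normc a) _ _ (sqint_Lfun sf) (sqint_Lfun sg).
move: (sf) (sg); rewrite !inE => -[mrf mif _] [mrg mig _] h.
have mr : measurable_fun [set: R] (fun x => complex.Re ((a *: f + g) x)).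
  under eq_fun do rewrite ReD ReZ.
  apply: measurable_funD => //; apply: measurable_funB;
    exact: measurable_funM.
have mi : measurable_fun [set: R] (fun x => complex.Im ((a *: f + g) x)).
  under eq_fun do rewrite ImD ImZ.
  apply: measurable_funD => //; apply: measurable_funD;
    exact: measurable_funM.
split=> //; apply: (le_lt_trans (le_Lnorm2 _ _ _)) (set_mem (sub_Lfun_finLfun h)).
- exact: measurable_normc.
- exact: set_mem (sub_Lfun_mfun h).
- apply: aeW => x; rewrite ger0_norm ?normc_ge0// (le_trans _ (ler_norm _))//.
  by rewrite (le_trans (le_normcD _ _))// normcM.
Qed.

HB.instance Definition _ :=
  GRing.isSubmodClosed.Build _ _ sqint sqint_submod_closed.

End SquareIntegrable.

Record L2fun (R : realType) := MkL2fun {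
  L2fun_val :> R -> R[i] ;
  L2funP : L2fun_val \in sqint }.

HB.instance Definition _ (R : realType) :=
  [isSub of L2fun R for @L2fun_val R].
HB.instance Definition _ (R : realType) := [Choice of L2fun R by <:].
HB.instance Definition _ (R : realType) :=
  [SubChoice_isSubLmodule of L2fun R by <:].

Section NullFunctions.
Context {R : realType}.
Local Notation mu := (@lebesgue_measure R).

Definition null_L2fun : {pred L2fun R} :=
  mem [set f : L2fun R | {ae mu, forall x, f x = 0}].

Lemma null_L2fun_submod_closed : submod_closed null_L2fun.
Proof.
split; first by rewrite inE; exact: aeW.
move=> a f g; rewrite !inE => f0 g0.
apply: (@filterS2 _ _ (ae_filter_ringOfSetsType mu)) f0 g0 => x fx0 gx0.
have -> : (a *: f + g) x = a *: f x + g x by [].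
by rewrite fx0 gx0 scaler0 addr0.
Qed.

HB.instance Definition _ :=
  GRing.isSubmodClosed.Build _ _ null_L2fun null_L2fun_submod_closed.

End NullFunctions.

(* Square-integrable functions modulo almost-everywhere equality. *)
Definition L2 (R : realType) : Type := Quotient.quot (@null_L2fun R).
HB.instance Definition _ (R : realType) := GRing.Zmodule.on (L2 R).
HB.instance Definition _ (R : realType) := Quotient.on (L2 R).
Definition L2_repr (R : realType) (f : L2 R) : L2fun R := repr f.
(* A class acts as a function through a chosen representative. *)
Coercion L2_repr : L2 >-> L2fun.

Section L2Lmodule.
Context {R : realType}.
Implicit Types (f g : L2fun R) (u v : L2 R) (a b : R[i]).
Local Notation mu := (@lebesgue_measure R).
Local Notation cls := (\pi_(L2 R)).

Lemma L2_piP f g : cls f = cls g <-> {ae mu, forall x, f x = g x}.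
Proof.
split=> [/eqP|fg].
  rewrite eqmodE /= /Quotient.equiv inE; apply: (@filterS _ _ (ae_filter_ringOfSetsType mu)) => x.
  by move=> /eqP; rewrite subr_eq0 => /eqP.
apply/eqP; rewrite eqmodE /= /Quotient.equiv inE; apply: (@filterS _ _ (ae_filter_ringOfSetsType mu)) fg => x fgx.
by apply/eqP; rewrite subr_eq0; exact/eqP.
Qed.

Lemma L2_reprK u : cls (L2_repr u) = u.
Proof. exact: reprK. Qed.

Definition L2_scale a u : L2 R := cls (a *: L2_repr u).

Lemma L2_piZ a f : L2_scale a (cls f) = cls (a *: f).
Proof.
apply/L2_piP; have /L2_piP := L2_reprK (cls f).
by apply: (@filterS _ _ (ae_filter_ringOfSetsType mu)) => x ?; congr (a * _).
Qed.

Lemma L2_piD f g : cls (f + g) = cls f + cls g.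
Proof. exact: raddfD. Qed.

Lemma L2_scaleA a b u : L2_scale a (L2_scale b u) = L2_scale (a * b) u.
Proof. by rewrite -[u]L2_reprK !L2_piZ scalerA. Qed.

Lemma L2_scale1 : left_id 1 L2_scale.
Proof. by move=> u; rewrite -[u]L2_reprK !L2_piZ scale1r. Qed.

Lemma L2_scaleDr : right_distributive L2_scale +%R.
Proof.
by move=> a u v; rewrite -[u]L2_reprK -[v]L2_reprK -L2_piD !L2_piZ scalerDr L2_piD.
Qed.

Lemma L2_scaleDl u : {morph L2_scale^~ u : a b / a + b}.
Proof. by move=> a b; rewrite -[u]L2_reprK !L2_piZ scalerDl L2_piD. Qed.

HB.instance Definition _ := GRing.Zmodule_isLmodule.Build R[i] (L2 R)
  L2_scaleA L2_scale1 L2_scaleDr L2_scaleDl.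

End L2Lmodule.

Section L2Norm.
Context {R : realType}.
Implicit Types (f g : L2fun R) (u v : L2 R) (a : R[i]).
Local Notation mu := (@lebesgue_measure R).
Local Notation cls := (\pi_(L2 R)).

Definition L2_norm u : R :=
  fine 'N[mu]_2%:E[EFin \o (fun x => normc (u x))].

Lemma L2fun_Lfun f : (fun x => normc (f x)) \in Lfun mu 2%:E.
Proof. exact: sqint_Lfun (L2funP f). Qed.

Lemma measurable_normc_L2fun f :
  measurable_fun [set: R] (fun x => normc (f x)).
Proof. exact: set_mem (sub_Lfun_mfun (L2fun_Lfun f)). Qed.

Lemma Lnorm_L2fun_fin f :
  ('N[mu]_2%:E[EFin \o (fun x => normc (f x))])%E \is a fin_num.
Proof.
rewrite ge0_fin_numE ?Lnorm_ge0//.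
exact: set_mem (sub_Lfun_finLfun (L2fun_Lfun f)).
Qed.

Lemma L2_norm_pi f :
  L2_norm (cls f) = fine 'N[mu]_2%:E[EFin \o (fun x => normc (f x))].
Proof.
have := L2_reprK (cls f); move/L2_piP => rf.
congr fine; apply/le_anti/andP; split; apply: le_Lnorm2;
  try exact: measurable_normc_L2fun;
  by apply: (@filterS _ _ (ae_filter_ringOfSetsType mu)) rf => x ->.
Qed.

Lemma L2_norm_ge0 u : 0 <= L2_norm u.
Proof. by rewrite fine_ge0// Lnorm_ge0. Qed.

Lemma L2_normD u v : L2_norm (u + v) <= L2_norm u + L2_norm v.
Proof.
rewrite -[u]L2_reprK -[v]L2_reprK -L2_piD !L2_norm_pi.
set f := L2_repr u; set g := L2_repr v.
rewrite -fineD ?Lnorm_L2fun_fin//.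
apply: fine_le; rewrite ?fin_numD ?Lnorm_L2fun_fin//.
have mn := measurable_normc_L2fun.
have p1 : (1 <= 2%:E :> \bar R)%E by rewrite lee_fin ler1n.
apply: (le_trans _ (eminkowski mu (mn f) (mn g) p1)).
apply: le_Lnorm2; [exact: mn|exact: measurable_funD|apply: aeW => x].
rewrite ger0_norm ?normc_ge0// (le_trans _ (ler_norm _))//.
exact: le_normcD.
Qed.

Lemma L2_normZ a u : L2_norm (a *: u) = normc a * L2_norm u.
Proof.
have p1 : (1 <= 2%:E :> \bar R)%E by rewrite lee_fin ler1n.
rewrite -[u]L2_reprK [a *: _]L2_piZ !L2_norm_pi.
set f := L2_repr u.
rewrite (_ : _ \o _ =
    EFin \o (normc a \*: (Lfun_Sub p1 (L2fun_Lfun f) : R -> R))); last first.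
  by apply/funext => x; congr EFin; exact: normcM.
by rewrite LnormZ fineM ?Lnorm_L2fun_fin//= ger0_norm// normc_ge0.
Qed.

Lemma L2_norm_eq0 u : L2_norm u = 0 -> u = 0.
Proof.
rewrite -[u]L2_reprK; set f := L2_repr u.
rewrite L2_norm_pi => f0.
have p1 : (1 <= 2%:E :> \bar R)%E by rewrite lee_fin ler1n.
have := @fine_Lnormr_eq0 _ _ _ mu _ p1 (Lfun_Sub p1 (L2fun_Lfun f)) f0.
rewrite -(raddf0 cls) => nf0; apply/L2_piP.
by apply: (@filterS _ _ (ae_filter_ringOfSetsType mu)) nf0 => x /(_ I)/eq0_normc.
Qed.

Lemma L2_normCD u v : (L2_norm (u + v))%:C <= (L2_norm u)%:C + (L2_norm v)%:C.
Proof. by rewrite -rmorphD/= lecR L2_normD. Qed.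

Lemma L2_normCZ a u : (L2_norm (a *: u))%:C = `|a| * (L2_norm u)%:C.
Proof. by rewrite L2_normZ rmorphM. Qed.

Lemma L2_normC_eq0 u : (L2_norm u)%:C = 0 -> u = 0.
Proof. by case=> /L2_norm_eq0. Qed.

(* The norm of an R[i]-normed module takes its values in R[i]. *)
HB.instance Definition _ := @Lmodule_isNormed.Build R[i] (L2 R)
  (fun u => (L2_norm u)%:C) L2_normCD L2_normCZ L2_normC_eq0.

End L2Norm.

Section Multipliers.
Context {R : realType}.
Implicit Types (f g u v : L2 R) (m : nat -> R[i]) (Phi Psi : nat -> L2 R).
Local Notation mu := (@lebesgue_measure R).

(* Linear in the first argument; the two components are the real and imaginary
   parts of the integral of u times the conjugate of v. *)
Definition L2_dot u v : R[i] :=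
  (\int[mu]_x complex.Re (u x * conjc (v x))) +i*
  (\int[mu]_x complex.Im (u x * conjc (v x))).

Definition unconditionally_convergent (w : nat -> L2 R) : Prop :=
  forall s : nat -> nat, bijective s -> cvgn (series (w \o s)).

Definition multiplier_term m Phi Psi f (n : nat) : L2 R :=
  (m n * L2_dot f (Psi n)) *: Phi n.

Definition multiplier m Phi Psi f : L2 R :=
  limn (series (multiplier_term m Phi Psi f)).

Definition multiplier_unconditionally_convergent m Phi Psi : Prop :=
  forall f, unconditionally_convergent (multiplier_term m Phi Psi f).

Definition bounded_operator (T : L2 R -> L2 R) : Prop :=
  exists K : R, forall f, L2_norm (T f) <= K * L2_norm f.

Definition invertible_operator (M : L2 R -> L2 R) : Prop :=
  exists T : {linear L2 R -> L2 R},
    [/\ bounded_operator T, forall f, M (T f) = f & forall f, T (M f) = f].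

Definition norm_bounded_below m : Prop :=
  0 < inf (range (fun n => normc (m n))).

Definition is_frame Phi : Prop :=
  exists A B : R, [/\ 0 < A, A <= B & forall h : L2 R,
    ((A * L2_norm h ^+ 2)%:E <=
       \sum_(n <oo) (normc (L2_dot h (Phi n)) ^+ 2)%:E)%E /\
    (\sum_(n <oo) (normc (L2_dot h (Phi n)) ^+ 2)%:E <=
       (B * L2_norm h ^+ 2)%:E)%E].

Definition expi (t : R) : R[i] := cos t +i* sin t.

(* In both systems the family indexed by int * int is enumerated by an
   arbitrary bijection e; equality is almost everywhere, and affine changes of
   variable preserve null sets, so the representative of g is irrelevant. *)
Definition is_gabor_system g Phi : Prop :=
  exists a b : R, [/\ 0 < a, 0 < b &
    exists2 e : nat -> int * int, bijective e &
      forall n, let: (k, l) := e n in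
        {ae mu, forall x : R, Phi n x =
          expi (2 * pi * l%:~R * b * x) * g (x - k%:~R * a)}].

Definition is_wavelet_system g Phi : Prop :=
  exists a b : R, [/\ 1 < a, 0 < b &
    exists2 e : nat -> int * int, bijective e &
      forall n, let: (j, k) := e n in
        {ae mu, forall x : R, Phi n x =
          (a `^ (j%:~R / 2))%:C * g (a ^ j * x - k%:~R * b)}].

End Multipliers.

(* Main.v *)
(* All phi_n share one norm p > 0, and all psi_n one norm q > 0, since
   modulations, translations and normalized dilations preserve the L^2 norm.
   Unconditional convergence and uniform boundedness give a single C with
   |sum_(k in F) m_k <f, psi_k> phi_k| <= C |f| for all finite F and all f.
   Choosing signs such that |sum +-x_k|^2 >= sum |x_k|^2 turns this bound, applied
   to the operators and to their adjoints, into sum |m_k <f, psi_k>|^2 p^2 <=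
   (2C|f|)^2 and sum |m_k <h, phi_k>|^2 q^2 <= (2C|h|)^2. As m is bounded below,
   both (m_k phi_k) and (psi_k) are Bessel, so c = m and d = 1 will do: the lower
   frame bounds follow from M T = T M = 1 and boundedness of T. *)

Require Import Defs.
From mathcomp Require Import all_boot all_order all_algebra complex.
From mathcomp Require Import all_classical all_reals all_analysis.
From mathcomp Require Import measurable_realfun generic_quotient ring lra.

Set Implicit Arguments.
Unset Strict Implicit.
Unset Printing Implicit Defensive.

Import Order.TTheory GRing.Theory Num.Theory.
Import numFieldNormedType.Exports.
Import Normc.

Local Open Scope classical_set_scope.
Local Open Scope ring_scope.
Local Open Scope complex_scope.
Local Open Scope quotient_scope.

(** * The inner product of L2 *)

Section L2InnerProduct.
Context {R : realType}.
Implicit Types (f g h : L2fun R) (u v w : L2 R) (a b : R[i]).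
Local Notation mu := (@lebesgue_measure R).
Local Notation cls := (\pi_(L2 R)).

Lemma normc_conjc a : normc (conjc a) = normc a.
Proof. by case: a => x y /=; rewrite sqrrN. Qed.

Lemma normc_sqr a : normc a ^+ 2 = complex.Re a ^+ 2 + complex.Im a ^+ 2.
Proof. by rewrite Defs.normcE sqr_sqrtr// addr_ge0// sqr_ge0. Qed.

Lemma normcC (r : R) : normc r%:C = `|r|.
Proof. by rewrite Defs.normcE /= expr0n addr0 sqrtr_sqr. Qed.

Lemma le_Re_normc a : `|complex.Re a| <= normc a.
Proof.
rewrite -(ler_pXn2r (n := 2)) ?nnegrE ?normc_ge0// normc_sqr.
by rewrite real_normK ?num_real// lerDl sqr_ge0.
Qed.

Lemma le_Im_normc a : `|complex.Im a| <= normc a.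
Proof.
rewrite -(ler_pXn2r (n := 2)) ?nnegrE ?normc_ge0// normc_sqr.
by rewrite real_normK ?num_real// lerDr sqr_ge0.
Qed.

Lemma measurable_Re_L2fun f : measurable_fun [set: R] (fun x => complex.Re (f x)).
Proof. by have := L2funP f; rewrite inE => -[]. Qed.

Lemma measurable_Im_L2fun f : measurable_fun [set: R] (fun x => complex.Im (f x)).
Proof. by have := L2funP f; rewrite inE => -[]. Qed.

Lemma Lfun2_Re f : (fun x => complex.Re (f x)) \in Lfun mu 2%:E.
Proof.
apply/andP; split; rewrite inE /=; first exact: measurable_Re_L2fun.
apply: le_lt_trans (set_mem (sub_Lfun_finLfun (L2fun_Lfun f))).
apply: le_Lnorm2; [exact: measurable_Re_L2fun|exact: measurable_normc_L2fun|].
by apply: aeW => x; rewrite (ger0_norm (normc_ge0 _)) le_Re_normc.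
Qed.

Lemma Lfun2_Im f : (fun x => complex.Im (f x)) \in Lfun mu 2%:E.
Proof.
apply/andP; split; rewrite inE /=; first exact: measurable_Im_L2fun.
apply: le_lt_trans (set_mem (sub_Lfun_finLfun (L2fun_Lfun f))).
apply: le_Lnorm2; [exact: measurable_Im_L2fun|exact: measurable_normc_L2fun|].
by apply: aeW => x; rewrite (ger0_norm (normc_ge0 _)) le_Im_normc.
Qed.

Lemma Re_mul_conjc a b : complex.Re (a * conjc b) =
  complex.Re a * complex.Re b + complex.Im a * complex.Im b.
Proof. by case: a b => [? ?] [? ?] /=; rewrite mulrN opprK. Qed.

Lemma Im_mul_conjc a b : complex.Im (a * conjc b) =
  complex.Im a * complex.Re b - complex.Re a * complex.Im b.
Proof. by case: a b => [? ?] [? ?] /=; rewrite mulrN addrC. Qed.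

(** Expanding leaves products of two square-integrable real functions, integrable by Hölder. *)
Lemma integrable_Re_mul_conjc f g :
  mu.-integrable [set: R] (EFin \o (fun x => complex.Re (f x * conjc (g x)))).
Proof.
under [X in integrable _ _ X]eq_fun do rewrite /= Re_mul_conjc EFinD.
apply: integrableD => //; apply/Lfun1_integrable/Lfun2_mul_Lfun1;
  [exact: Lfun2_Re|exact: Lfun2_Re|exact: Lfun2_Im|exact: Lfun2_Im].
Qed.

Lemma integrable_Im_mul_conjc f g :
  mu.-integrable [set: R] (EFin \o (fun x => complex.Im (f x * conjc (g x)))).
Proof.
under [X in integrable _ _ X]eq_fun do rewrite /= Im_mul_conjc EFinB.
apply: integrableB => //; apply/Lfun1_integrable/Lfun2_mul_Lfun1;
  [exact: Lfun2_Im|exact: Lfun2_Re|exact: Lfun2_Re|exact: Lfun2_Im].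
Qed.

(** The inner product on representatives, where algebra is pointwise; [L2_dot_pi] carries it to
    classes. *)
Definition L2fun_dot f g : R[i] :=
  (\int[mu]_x complex.Re (f x * conjc (g x))) +i*
  (\int[mu]_x complex.Im (f x * conjc (g x))).

Lemma eq_ae_L2fun_dot f f' g g' :
  {ae mu, forall x, f x = f' x} -> {ae mu, forall x, g x = g' x} ->
  L2fun_dot f g = L2fun_dot f' g'.
Proof.
move=> ff' gg'; congr (_ +i* _); congr fine; apply: ae_eq_integral => //.
- exact: (measurable_int mu (integrable_Re_mul_conjc f g)).
- exact: (measurable_int mu (integrable_Re_mul_conjc f' g')).
- apply: (@filterS2 _ _ (ae_filter_ringOfSetsType mu)) ff' gg' => x fx gx _.
  by rewrite fx gx.
- exact: (measurable_int mu (integrable_Im_mul_conjc f g)).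
- exact: (measurable_int mu (integrable_Im_mul_conjc f' g')).
- apply: (@filterS2 _ _ (ae_filter_ringOfSetsType mu)) ff' gg' => x fx gx _.
  by rewrite fx gx.
Qed.

Lemma L2_dot_pi f g : L2_dot (cls f) (cls g) = L2fun_dot f g.
Proof.
by apply: eq_ae_L2fun_dot; apply/L2_piP; rewrite L2_reprK.
Qed.

Lemma L2fun_dotDl f g h : L2fun_dot (f + g) h = L2fun_dot f h + L2fun_dot g h.
Proof.
apply/eqP; rewrite eq_complex; apply/andP; split; apply/eqP => /=.
- rewrite -RintegralD//; try exact: integrable_Re_mul_conjc.
  by apply: eq_Rintegral => x _; rewrite -ReD -mulrDl.
- rewrite -RintegralD//; try exact: integrable_Im_mul_conjc.
  by apply: eq_Rintegral => x _; rewrite -ImD -mulrDl.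
Qed.

Lemma L2fun_dotZl a f h : L2fun_dot (a *: f) h = a * L2fun_dot f h.
Proof.
have ir := integrable_Re_mul_conjc f h.
have ii := integrable_Im_mul_conjc f h.
have sc (c : R) (k : R -> R) : mu.-integrable [set: R] (EFin \o k) ->
    mu.-integrable [set: R] (EFin \o (fun x => c * k x)).
  move=> ik; rewrite (_ : _ \o _ = (fun x => c%:E * (EFin \o k) x)%E)//.
  exact: integrableZl.
apply/eqP; rewrite eq_complex; apply/andP; split; apply/eqP.
- transitivity (complex.Re a * complex.Re (L2fun_dot f h)
              - complex.Im a * complex.Im (L2fun_dot f h)); last by case: a.
  rewrite -!RintegralZl// -RintegralB//; try exact: sc.
  by apply: eq_Rintegral => x _; rewrite -ReZ; congr complex.Re; exact: (esym (mulrA a (f x) _)).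
- transitivity (complex.Re a * complex.Im (L2fun_dot f h)
              + complex.Im a * complex.Re (L2fun_dot f h)); last by case: a.
  rewrite -!RintegralZl// -RintegralD//; try exact: sc.
  by apply: eq_Rintegral => x _; rewrite -ImZ; congr complex.Im; exact: (esym (mulrA a (f x) _)).
Qed.

Lemma L2_dotDl u v w : L2_dot (u + v) w = L2_dot u w + L2_dot v w.
Proof.
rewrite -[u]L2_reprK -[v]L2_reprK -[w]L2_reprK -L2_piD !L2_dot_pi.
exact: L2fun_dotDl.
Qed.

Lemma L2_dotZl a u w : L2_dot (a *: u) w = a * L2_dot u w.
Proof.
by rewrite -[u]L2_reprK -[w]L2_reprK [a *: _]L2_piZ !L2_dot_pi L2fun_dotZl.
Qed.

Lemma L2_dotC u v : L2_dot u v = conjc (L2_dot v u).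
Proof.
apply/eqP; rewrite eq_complex; apply/andP; split; apply/eqP => /=.
- by apply: eq_Rintegral => x _; rewrite !Re_mul_conjc mulrC [X in _ + X]mulrC.
- rewrite -mulN1r -RintegralZl//; last exact: integrable_Im_mul_conjc.
  apply: eq_Rintegral => x _; rewrite !Im_mul_conjc mulN1r opprB.
  by rewrite mulrC [X in _ - X]mulrC.
Qed.

Lemma L2_norm_sqr_pi f :
  ((L2_norm (cls f) ^+ 2)%:E = \int[mu]_x ((normc (f x)) ^+ 2)%:E)%E.
Proof.
rewrite -[L2_norm _ ^+ 2]powR_mulrn ?L2_norm_ge0// -poweR_EFin L2_norm_pi.
rewrite fineK ?Lnorm_L2fun_fin// poweR_Lnorm ?pnatr_eq0//.
apply: eq_integral => x _.
by rewrite /= ger0_norm ?normc_ge0// powR_mulrn ?normc_ge0.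
Qed.

Lemma L2_norm_sqrE u :
  ((L2_norm u ^+ 2)%:E = \int[mu]_x ((normc (u x)) ^+ 2)%:E)%E.
Proof. by rewrite -L2_norm_sqr_pi L2_reprK. Qed.

Lemma L2_dotuu u : L2_dot u u = (L2_norm u ^+ 2)%:C.
Proof.
apply/eqP; rewrite eq_complex; apply/andP; split; apply/eqP => /=.
- rewrite /Rintegral; under eq_integral do rewrite Re_mul_conjc -!expr2 -normc_sqr.
  by rewrite -L2_norm_sqrE.
- rewrite (_ : (fun _ => _) = cst 0) ?Rintegral_cst ?mul0r//.
  by apply/funext => x; rewrite Im_mul_conjc mulrC subrr.
Qed.

Lemma L2_dotDr u v w : L2_dot u (v + w) = L2_dot u v + L2_dot u w.
Proof. by rewrite L2_dotC L2_dotDl (L2_dotC u v) (L2_dotC u w); exact: rmorphD. Qed.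

Lemma L2_dotZr a u w : L2_dot u (a *: w) = conjc a * L2_dot u w.
Proof. by rewrite L2_dotC L2_dotZl (L2_dotC u w); exact: rmorphM. Qed.

Lemma L2_dot_suml (I : Type) (r : seq I) (P : pred I) (F : I -> L2 R) v :
  L2_dot (\sum_(i <- r | P i) F i) v = \sum_(i <- r | P i) L2_dot (F i) v.
Proof.
elim/big_rec2: _ => [|i y x _ <-]; last by rewrite L2_dotDl.
by rewrite -[X in L2_dot X](scale0r (0 : L2 R)) L2_dotZl mul0r.
Qed.

Lemma L2_norm_sqrD u v : L2_norm (u + v) ^+ 2 =
  L2_norm u ^+ 2 + L2_norm v ^+ 2 + 2 * complex.Re (L2_dot u v).
Proof.
have := L2_dotuu (u + v).
rewrite L2_dotDl !L2_dotDr (L2_dotC v u) !L2_dotuu => /eqP.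
by rewrite eq_complex => /andP[/eqP + _]; rewrite !ReD/= => <-; case: (L2_dot u v) => x y /=; ring.
Qed.

(** The squared norm of |v|^2 u - <u, v> v expands to |v|^2 (|u|^2 |v|^2 - |<u, v>|^2), so this
    product is nonnegative. *)
Lemma L2_CauchySchwarz u v : normc (L2_dot u v) <= L2_norm u * L2_norm v.
Proof.
set t := L2_dot u v; set q := L2_norm v.
have q0 : 0 <= q := L2_norm_ge0 v.
have := sqr_ge0 (L2_norm ((q ^+ 2)%:C *: u + (- t) *: v)).
rewrite L2_norm_sqrD !L2_normZ L2_dotZl L2_dotZr -/t normcN normcC.
rewrite ger0_norm ?sqr_ge0// -/q => le0.
(* The factor q^2 is cancelled below, so v = 0 is treated apart. *)
have [q_eq0|q_neq0] := eqVneq q 0.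
  rewrite q_eq0 mulr0 /t (L2_norm_eq0 q_eq0) -(scale0r (0 : L2 R)) L2_dotZr.
  by rewrite conjc0 mul0r normc0.
have q_gt0 : 0 < q by rewrite lt_neqAle eq_sym q_neq0.
have {le0} : 0 <= q ^+ 2 * (q ^+ 2 * L2_norm u ^+ 2 - normc t ^+ 2).
  rewrite (le_trans le0)// (exprMn _ (normc t)) !normc_sqr.
  move: t {le0} => [x y] /=.
  by rewrite le_eqVlt; apply/orP; left; apply/eqP; ring.
rewrite pmulr_rge0 ?exprn_gt0// subr_ge0 mulrC -exprMn ler_pXn2r//.
  by rewrite nnegrE normc_ge0.
by rewrite nnegrE mulr_ge0// L2_norm_ge0.
Qed.

End L2InnerProduct.

(** * Completeness *)

Section ComplexSeries.
Context {R : realType}.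
Implicit Types (a : nat -> R[i]) (b : nat -> R).

Lemma ReB (z t : R[i]) : complex.Re (z - t) = complex.Re z - complex.Re t.
Proof. by case: z t => [? ?] [? ?]. Qed.

Lemma ImB (z t : R[i]) : complex.Im (z - t) = complex.Im z - complex.Im t.
Proof. by case: z t => [? ?] [? ?]. Qed.

Lemma Re_sum (I : Type) (r : seq I) (P : pred I) (F : I -> R[i]) :
  complex.Re (\sum_(i <- r | P i) F i) = \sum_(i <- r | P i) complex.Re (F i).
Proof. by rewrite (big_morph _ (@ReD R) (id1 := 0)). Qed.

Lemma Im_sum (I : Type) (r : seq I) (P : pred I) (F : I -> R[i]) :
  complex.Im (\sum_(i <- r | P i) F i) = \sum_(i <- r | P i) complex.Im (F i).
Proof. by rewrite (big_morph _ (@ImD R) (id1 := 0)). Qed.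

Lemma le_normc_sum (I : Type) (r : seq I) (P : pred I) (F : I -> R[i]) :
  normc (\sum_(i <- r | P i) F i) <= \sum_(i <- r | P i) normc (F i).
Proof.
elim/big_rec2: _ => [|i y x _ le_xy]; first by rewrite normc0.
by rewrite (le_trans (le_normcD _ _))// lerD2l.
Qed.

(* The limit superior makes the sum a measurable function of parameters even
   where the series diverges. *)
Definition rsum b : R := fine (limn_esup (fun n => (series b n)%:E)).

Definition csum a : R[i] :=
  rsum (fun k => complex.Re (a k)) +i* rsum (fun k => complex.Im (a k)).

(** Absolute convergence turns the limit superior in [rsum] into an ordinary limit. *)
Lemma cvg_rsum b c : (forall N, \sum_(0 <= k < N) `|b k| <= c) ->
  series b @ \oo --> rsum b.
Proof.
move=> bc.
have /cvg_ex[/= l bl] : cvgn (series b).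
  apply: normed_cvg; apply: nondecreasing_is_cvgn.
    by apply: nondecreasing_series => k _ _; exact: normr_ge0.
  by exists c => _ [N _ <-]; exact: bc.
rewrite /rsum; have -> : limn_esup (fun n => (series b n)%:E) = l%:E.
  by apply: (cvg_limn_einf_sup _).2; exact: (cvg_comp _ _ bl).
exact: bl.
Qed.

Lemma csum_tail a n c : (forall N, \sum_(n <= k < N) normc (a k) <= c) ->
  normc (csum a - \sum_(0 <= k < n) a k) <= c.
Proof.
move=> ac.
(* The hypothesis controls only the tail; adding the head bounds all partial sums, as convergence
   requires. *)
pose d := \sum_(0 <= k < n) normc (a k) + c.
have c0 : 0 <= c by have := ac n; rewrite big_geq.
have ad N : \sum_(0 <= k < N) normc (a k) <= d.
  rewrite (@le_trans _ _ (\sum_(0 <= k < maxn n N) normc (a k)))//.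
    rewrite [leRHS](big_cat_nat _ (leq_maxr n N))//= lerDl sumr_ge0// => k _.
    exact: normc_ge0.
  by rewrite (big_cat_nat _ (leq_maxl n N))//= lerD2l.
have part (p : R[i] -> R) : (forall z, `|p z| <= normc z) ->
    series (fun k => p (a k)) @ \oo --> rsum (fun k => p (a k)).
  move=> pz; apply: (@cvg_rsum _ d) => N.
  by rewrite (le_trans _ (ad N))// ler_sum.
have cr := part _ (@le_Re_normc R); have ci := part _ (@le_Im_normc R).
set s := \sum_(0 <= k < n) a k.
rewrite -(ler_pXn2r (n := 2)) ?nnegrE ?normc_ge0// normc_sqr.
have cv : (fun N => (series (fun k => complex.Re (a k)) N - complex.Re s) ^+ 2 +
    (series (fun k => complex.Im (a k)) N - complex.Im s) ^+ 2) @ \oo -->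
    (rsum (fun k => complex.Re (a k)) - complex.Re s) ^+ 2 +
    (rsum (fun k => complex.Im (a k)) - complex.Im s) ^+ 2.
  rewrite !expr2; under eq_fun do rewrite !expr2.
  by apply: cvgD; apply: cvgM; apply: cvgB => //; exact: cvg_cst.
rewrite ReB ImB.
apply: (cvgr_to_le cv); near=> N.
have nN : (n <= N)%N by near: N; exact: nbhs_infty_ge.
rewrite /series/= -Re_sum -Im_sum.
set t := \sum_(0 <= k < N) a k.
have -> : (complex.Re t - complex.Re s) ^+ 2 + (complex.Im t - complex.Im s) ^+ 2
    = normc (t - s) ^+ 2 by rewrite normc_sqr ReB ImB.
rewrite ler_pXn2r ?nnegrE ?normc_ge0//.
by rewrite /t /s (sub_series_geq a nN) (le_trans (le_normc_sum _ _ _)).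
Unshelve. all: by end_near. Qed.

End ComplexSeries.

(** * Convergence in L2 of norm-summable series *)

Section RieszFischer.
Context {R : realType}.
Local Notation mu := (@lebesgue_measure R).
Local Notation cls := (\pi_(L2 R)).

Lemma integral_sqint (f : R -> R[i]) :
  measurable_fun [set: R] (fun x => complex.Re (f x)) ->
  measurable_fun [set: R] (fun x => complex.Im (f x)) ->
  (\int[mu]_x (normc (f x) ^+ 2)%:E < +oo)%E -> f \in sqint.
Proof.
move=> mr mi foo; rewrite inE; split => //.
rewrite /finite_norm; apply: (@lty_poweRy _ _ 2); first by rewrite pnatr_eq0.
rewrite poweR_Lnorm ?pnatr_eq0//; apply: le_lt_trans foo.
rewrite le_eqVlt; apply/orP; left; apply/eqP; apply: eq_integral => x _.
by rewrite /= ger0_norm ?normc_ge0// powR_mulrn ?normc_ge0.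
Qed.

Lemma sqint_abs (f : L2fun R) : (fun x => (normc (f x))%:C) \in sqint.
Proof.
apply: integral_sqint; [exact: measurable_normc_L2fun|exact: measurable_cst|].
under eq_integral do rewrite normcC ger0_norm ?normc_ge0//.
by rewrite -L2_norm_sqr_pi ltry.
Qed.

(** The modulus is kept inside L2 so that the triangle inequality for [L2_norm] applies to sums of
    moduli. *)
Definition L2fun_abs (f : L2fun R) : L2fun R := MkL2fun (sqint_abs f).

Lemma L2_norm_abs (f : L2fun R) : L2_norm (cls (L2fun_abs f)) = L2_norm (cls f).
Proof.
rewrite !L2_norm_pi; congr fine; apply: eq_Lnorm => x /=.
by rewrite expr0n addr0 sqrtr_sqr ger0_norm ?normc_ge0.
Qed.

Lemma L2fun_sumE (I : Type) (r : seq I) (P : pred I) (F : I -> L2fun R) (x : R) :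
  (\sum_(i <- r | P i) F i : L2fun R) x = \sum_(i <- r | P i) F i x.
Proof. by rewrite (big_morph (fun f : L2fun R => f x) (op1 := +%R) (id1 := 0)). Qed.

Lemma L2_pi_sum (I : Type) (r : seq I) (P : pred I) (F : I -> L2fun R) :
  cls (\sum_(i <- r | P i) F i) = \sum_(i <- r | P i) cls (F i).
Proof. exact: raddf_sum. Qed.

Lemma L2_norm0 : L2_norm (0 : L2 R) = 0.
Proof. by rewrite -(scale0r (0 : L2 R)) L2_normZ normc0 mul0r. Qed.

Lemma le_L2_norm_sum (I : Type) (r : seq I) (P : pred I) (F : I -> L2 R) :
  L2_norm (\sum_(i <- r | P i) F i) <= \sum_(i <- r | P i) L2_norm (F i).
Proof.
elim/big_rec2: _ => [|i y x _ le_xy]; first by rewrite L2_norm0.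
by rewrite (le_trans (L2_normD _ _))// lerD2l.
Qed.

Lemma measurable_rsum (b : nat -> R -> R) :
  (forall k, measurable_fun [set: R] (b k)) ->
  measurable_fun [set: R] (fun x => rsum (b^~ x)).
Proof.
move=> mb; rewrite /rsum.
apply: (measurableT_comp (f := @fine R)); first exact: fine_measurable.
apply: (measurable_fun_limn_esup (f := fun n x => (series (b^~ x) n)%:E)) => n.
by apply/measurable_EFinP; apply: measurable_sum.
Qed.

(** Minkowski bounds the norm of the sums of moduli from index n on by [B n]. Monotone convergence
    carries this bound to their pointwise limit, which dominates the remainder of the pointwise sum
    [f]. *)
Lemma Riesz_Fischer (g : nat -> L2 R) (B : nat -> R) :
  (forall n N, \sum_(n <= k < N) L2_norm (g k) <= B n) ->
  exists f : L2 R, forall n, L2_norm (f - \sum_(0 <= k < n) g k) <= B n.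
Proof.
move=> gB.
pose P n N x := \sum_(n <= k < N) normc (g k x).
have P0 n N x : 0 <= P n N x by apply: sumr_ge0 => k _; exact: normc_ge0.
have mP n N : measurable_fun [set: R] (P n N).
  by apply: measurable_sum => k; exact: measurable_normc_L2fun.
have ndP n x : {homo P n ^~ x : N M / (N <= M)%N >-> N <= M}.
  move=> N M NM; rewrite /P; have [nN|Nn] := leqP n N.
    rewrite [leRHS](big_cat_nat nN NM)//= lerDl sumr_ge0// => k _.
    exact: normc_ge0.
  by rewrite big_geq ?P0// ltnW.
have B0 n : 0 <= B n by have := gB n n; rewrite big_geq.
have intP n N : (\int[mu]_x (P n N x ^+ 2)%:E <= (B n ^+ 2)%:E)%E.
  pose s := \sum_(n <= k < N) L2fun_abs (g k).
  have -> : (\int[mu]_x (P n N x ^+ 2)%:E = (L2_norm (cls s) ^+ 2)%:E)%E.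
    rewrite L2_norm_sqr_pi; apply: eq_integral => x _.
    rewrite /s L2fun_sumE/= -(rmorph_sum (real_complex R)) normcC ger0_norm//.
    exact: P0.
  rewrite lee_fin ler_pXn2r ?nnegrE ?L2_norm_ge0//.
  rewrite (le_trans _ (gB n N))// /s L2_pi_sum (le_trans (le_L2_norm_sum _ _ _))//.
  by apply: ler_sum => k _; rewrite L2_norm_abs L2_reprK.
pose f x := csum (fun k => g k x).
have mfr : measurable_fun [set: R] (fun x => complex.Re (f x)).
  by apply: measurable_rsum => k; exact: measurable_Re_L2fun.
have mfi : measurable_fun [set: R] (fun x => complex.Im (f x)).
  by apply: measurable_rsum => k; exact: measurable_Im_L2fun.
pose S n : L2fun R := \sum_(0 <= k < n) (g k : L2fun R).
have intf n : (\int[mu]_x (normc (f x - S n x) ^+ 2)%:E <= (B n ^+ 2)%:E)%E.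
  have nd2 x : {homo (fun N => (P n N x ^+ 2)%:E) : N M / (N <= M)%N >-> (N <= M)%E}.
    by move=> N M NM; rewrite lee_fin ler_pXn2r ?nnegrE ?P0// ndP.
  have m2 N : measurable_fun [set: R] (fun x => (P n N x ^+ 2)%:E).
    by apply/measurable_EFinP; exact: measurable_funX.
  apply: (@le_trans _ _ (\int[mu]_x limn (fun N => (P n N x ^+ 2)%:E))%E).
    apply: ge0_le_integral => //.
    - by move=> x _; rewrite lee_fin sqr_ge0.
    - apply/measurable_EFinP; apply: measurable_funX.
      apply: measurable_normc.
        under eq_fun do rewrite ReB.
        by apply: measurable_funB => //; exact: measurable_Re_L2fun.
      under eq_fun do rewrite ImB.
      by apply: measurable_funB => //; exact: measurable_Im_L2fun.
    - apply: (emeasurable_fun_cvg (fun N x => (P n N x ^+ 2)%:E)) => // x _.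
      exact: ereal_nondecreasing_is_cvgn.
    - move=> x _; set L := limn _.
      have PL N : ((P n N x ^+ 2)%:E <= L)%E.
        apply: lime_ge; first exact: ereal_nondecreasing_is_cvgn.
        by near=> M; apply: nd2; near: M; exact: nbhs_infty_ge.
      (* Where the limit is infinite the bound is trivial, so convergence almost everywhere need not
         be proved separately; where it is a real r, [csum_tail] applies with bound sqrt r. *)
      case: L PL => [r| |] PL; [|by rewrite leey|by have := PL 0%N].
      have r0 : 0 <= r by rewrite (le_trans (sqr_ge0 (P n 0%N x)))// -lee_fin.
      rewrite lee_fin -[leRHS]sqr_sqrtr// ler_pXn2r ?nnegrE ?normc_ge0//.
      rewrite /S L2fun_sumE /f; apply: csum_tail => N.
      rewrite -[leLHS]ger0_norm ?P0// -sqrtr_sqr ler_wsqrtr//.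
      by rewrite -lee_fin; exact: PL.
  rewrite monotone_convergence//; last by move=> N x _; rewrite lee_fin sqr_ge0.
  apply: lime_le; last by near=> N; exact: intP.
  apply: ereal_nondecreasing_is_cvgn => N M NM.
  apply: ge0_le_integral; [by []| |exact: m2|exact: m2|].
    by move=> x _; rewrite lee_fin sqr_ge0.
  by move=> x _; exact: nd2.
have sf : f \in sqint.
  apply: integral_sqint => //.
  (* At n = 0 the partial sum is empty, so the remainder is [f] itself. *)
  apply: le_lt_trans (ltry (B 0%N ^+ 2)); apply: le_trans (intf 0%N).
  rewrite le_eqVlt; apply/orP; left; apply/eqP; apply: eq_integral => x _.
  by rewrite /S L2fun_sumE big_geq// subr0.
exists (cls (MkL2fun sf)) => n.
have -> : \sum_(0 <= k < n) g k = cls (S n).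
  by rewrite L2_pi_sum; apply: eq_bigr => k _; rewrite L2_reprK.
rewrite -(ler_pXn2r (n := 2)) ?nnegrE ?L2_norm_ge0// -lee_fin.
have -> : cls (MkL2fun sf) - cls (S n) = cls (MkL2fun sf - S n) by rewrite raddfB.
by rewrite L2_norm_sqr_pi; exact: intf.
Unshelve. all: by end_near. Qed.

End RieszFischer.

(** * Uniform boundedness *)

Section UniformBoundedness.
Context {R : realType}.
Variables (I : Type) (p : I -> L2 R -> R).
Hypothesis pD : forall i x y, p i (x + y) <= p i x + p i y.
Hypothesis pZ : forall i (a : R[i]) x, p i (a *: x) = normc a * p i x.

Lemma seminorm0 i : p i 0 = 0.
Proof. by rewrite -(scale0r (0 : L2 R)) pZ normc0 mul0r. Qed.

Lemma seminormN i x : p i (- x) = p i x.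
Proof. by rewrite -scaleN1r pZ normcN normc1 mul1r. Qed.

(** N is the supremum of [p i] over the closed unit ball. It may not be attained, but N >= c > 0
    leaves room for a vector reaching three quarters of it. *)
Lemma seminorm_near_sup i K c : 0 < c ->
  (forall x, p i x <= K * L2_norm x) -> (exists x, c * L2_norm x < p i x) ->
  exists2 N, c <= N & (forall x, p i x <= N * L2_norm x) /\
    exists2 g, L2_norm g <= 1 & 3 / 4 * N <= p i g.
Proof.
move=> c0 pK [x0 px0].
pose E := [set p i y | y in [set y : L2 R | L2_norm y <= 1]].
have supE : has_sup E.
  split; first by exists (p i 0), 0 => //=; rewrite L2_norm0.
  exists `|K| => _ [y /= y1 <-]; rewrite (le_trans (pK y))//.
  rewrite (@le_trans _ _ (`|K| * L2_norm y))//; last by rewrite ler_piMr.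
  by rewrite ler_wpM2r ?L2_norm_ge0// ler_norm.
have unit_norm (x : L2 R) : 0 < L2_norm x -> L2_norm ((L2_norm x)^-1%:C *: x) = 1.
  move=> x_gt0; rewrite L2_normZ normcC gtr0_norm ?invr_gt0//.
  by rewrite mulVf ?gt_eqF.
have p_le_sup x : p i x <= sup E * L2_norm x.
  have [|x0'] := leP (L2_norm x) 0.
    rewrite le_eqVlt ltNge L2_norm_ge0 orbF => /eqP x0'.
    by rewrite (L2_norm_eq0 x0') seminorm0 L2_norm0 mulr0.
  have : p i ((L2_norm x)^-1%:C *: x) <= sup E.
    by apply: ub_le_sup; [exact: supE.2|exists ((L2_norm x)^-1%:C *: x); rewrite //= unit_norm].
  by rewrite pZ normcC gtr0_norm ?invr_gt0// ler_pdivrMl// mulrC.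
have x0_gt0 : 0 < L2_norm x0.
  rewrite lt_neqAle L2_norm_ge0 andbT eq_sym; apply/eqP => x00.
  by move: px0; rewrite (L2_norm_eq0 x00) seminorm0 L2_norm0 mulr0 ltxx.
have cE : c <= sup E.
  by rewrite -(ler_pM2r x0_gt0) (le_trans (ltW px0)).
exists (sup E) => //; split => //.
have [|_ [g g1 <-] lt_g] := @sup_adherent _ E (sup E / 4) _ supE.
  by rewrite divr_gt0// (lt_le_trans c0).
by exists g => //; rewrite (le_trans _ (ltW lt_g))//; lra.
Qed.

(* Sokal's gliding hump: since [max (p (x + y)) (p (x - y)) >= p y], a suitable
   sign of the n-th increment [y] makes [p (i n)] at least [p (i n) y]. *)
Lemma uniform_boundedness :
  (forall i, exists K, forall x, p i x <= K * L2_norm x) ->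
  (forall x, exists M, forall i, p i x <= M) ->
  exists2 C, 0 < C & forall i x, p i x <= C * L2_norm x.
Proof.
move=> pK pM; apply: contrapT => unb.
have hump n : exists t : I * L2 R * R, let: (i, g, N) := t in
    [/\ 4 * n.+1%:R * 3 ^+ n <= N, forall x, p i x <= N * L2_norm x,
        L2_norm g <= 1 & 3 / 4 * N <= p i g].
  (* The n-th increment has scale 3^-n and a quarter of 3^-n N survives the estimates; this
     threshold makes that quarter at least n + 1. *)
  pose c : R := 4 * n.+1%:R * 3 ^+ n.
  have c0 : 0 < c by rewrite !mulr_gt0// exprn_gt0.
  have [i [x px]] : exists i x, c * L2_norm x < p i x.
    apply: contrapT => noix; apply: unb; exists c => // i x.
    by rewrite leNgt; apply/negP => px; apply: noix; exists i, x.
  have [K Ki] := pK i.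
  have [N cN [pN [g g1 pg]]] := seminorm_near_sup c0 Ki (ex_intro _ x px).
  by exists (i, g, N).
have [t tP] := choice hump.
pose i n := (t n).1.1; pose g n := (t n).1.2; pose N n := (t n).2.
have {}tP n : [/\ 4 * n.+1%:R * 3 ^+ n <= N n, forall x, p (i n) x <= N n * L2_norm x,
    L2_norm (g n) <= 1 & 3 / 4 * N n <= p (i n) (g n)].
  by move: (tP n); rewrite /i /g /N; case: (t n) => [[]].
pose y n : L2 R := (3 ^- n)%:C *: g n.
pose step n x := if p (i n) (y n) <= p (i n) (x + y n) then y n else - y n.
pose F := fix F n : L2 R := if n is m.+1 then F m + step m (F m) else 0.
pose z n := step n (F n).
have Fz n : F n = \sum_(0 <= k < n) z k.
  elim: n => [|n IHn]; first by rewrite big_geq.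
  by rewrite big_nat_recr//= -IHn.
have e0 n : 0 < 3 ^- n :> R by rewrite invr_gt0 exprn_gt0.
have normz n : L2_norm (z n) <= 3 ^- n.
  have -> : L2_norm (z n) = L2_norm (y n).
    by rewrite /z /step; case: ifP => // _; rewrite -scaleN1r L2_normZ normcN normc1 mul1r.
  rewrite L2_normZ normcC gtr0_norm//.
  by case: (tP n) => _ _ g1 _; rewrite ler_piMr// ltW.
have geom n M : \sum_(n <= k < M) (3 ^- k : R) <= 3 / 2 * 3 ^- n.
  have [Mn|/ltnW nM] := leqP M n; first by rewrite big_geq// mulr_ge0// ltW.
  suff -> : \sum_(n <= k < M) (3 ^- k : R) = 3 / 2 * (3 ^- n - 3 ^- M).
    by rewrite ler_pM2l// gerBl ltW.
  elim: M nM => [|M IHM]; first by rewrite leqn0 => /eqP ->; rewrite big_geq// subrr mulr0.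
  rewrite leq_eqVlt => /predU1P[<-|nM]; first by rewrite big_geq// subrr mulr0.
  rewrite big_nat_recr//= IHM// exprS invfM.
  by set u := 3 ^- n; set v := 3 ^- M; lra.
(* The remainder bound is the full geometric tail from n on. *)
have [f fF] := @Riesz_Fischer R z (fun n => 3 / 2 * 3 ^- n)
  (fun n M => le_trans (ler_sum _ (fun k _ => normz k)) (geom n M)).
have [M Mf] := pM f.
pose n := Num.truncn M.
have [cN pN g1 pg] := tP n.
have py : p (i n) (y n) = 3 ^- n * p (i n) (g n) by rewrite pZ normcC gtr0_norm.
have pF : p (i n) (y n) <= p (i n) (F n.+1).
  (* If the plus sign was rejected, 2y = (F + y) - (F - y) forces the minus sign to give at least p
     y. *)
  rewrite /= /step; case: ifPn => //; rewrite -ltNge => lt_y.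
  have := pD (i n) (F n + y n) (- (F n - y n)).
  have -> : F n + y n + - (F n - y n) = 2%:R *: y n.
    by rewrite opprB addrC addrA subrK scaler_nat mulr2n.
  by rewrite seminormN pZ -(rmorph_nat (real_complex R)) normcC ger0_norm//; lra.
have pf := pD (i n) f (F n.+1 - f); rewrite addrC subrK in pf.
have pr : p (i n) (F n.+1 - f) <= N n * (3 / 2 * 3 ^- n.+1).
  rewrite (le_trans (pN _))//.
  have N0 : 0 <= N n by rewrite (le_trans _ cN)// !mulr_ge0// exprn_ge0.
  rewrite ler_wpM2l// -opprB -scaleN1r L2_normZ normcN normc1 mul1r Fz.
  exact: fF.
have h1 : 3 ^- n * (3 / 4 * N n) <= 3 ^- n * p (i n) (g n) by rewrite ler_pM2l.
have h2 : n.+1%:R * 4 <= 3 ^- n * N n.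
  rewrite ler_pdivlMl ?exprn_gt0//; apply: le_trans cN.
  by rewrite mulrC (mulrC (n.+1%:R)).
(* The later increments cost at most half of 3^-n N, against three quarters gained at step n. The
   value at [f] is thus at least n + 1 > M, a contradiction. *)
have h3 : N n * (3 / 2 * 3 ^- n.+1) = (3 ^- n * N n) / 2.
  by rewrite exprS invfM; set u := 3 ^- n; lra.
have : M < n.+1%:R by exact: truncnS_gt.
have := Mf (i n).
rewrite -{}py in h1; rewrite h3 in pr.
have h4 : 3 ^- n * (3 / 4 * N n) = 3 / 4 * (3 ^- n * N n) by rewrite mulrCA.
rewrite h4 in h1.
by lra.
Qed.

End UniformBoundedness.

(** * Unconditional convergence *)

Section SubsetSums.
Context {R : realType}.
Implicit Types w : nat -> L2 R.

(** Translates convergence for the R[i]-valued norm into real epsilons. *)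
Lemma L2_cvg_dist (u : nat -> L2 R) (l : L2 R) : u @ \oo --> l ->
  forall e, 0 < e -> exists n0, forall n, (n0 <= n)%N -> L2_norm (l - u n) < e.
Proof.
move=> ul e e0; have e0' : 0 < e%:C :> R[i] by rewrite ltcR.
have /cvgrPdist_lt/(_ _ e0')[n0 _ un] := ul.
exists n0 => n n0n; have /= := un n n0n.
by rewrite -ltcR.
Qed.

(** The iterates of [next] from 0 cut the integers into consecutive blocks. Permuting each block so
    that its selected indices come first makes every selected subsum a run of consecutive terms. *)
Lemma block_rearrangement (next : nat -> nat) (P : nat -> pred nat) :
  (forall n, (n < next n)%N) ->
  exists2 s : nat -> nat, bijective s & forall w n0, exists a b c : nat,
    [/\ (n0 <= a)%N, (a <= b)%N, (n0 <= c)%N &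
      \sum_(a <= j < b) w (s j) = \sum_(c <= j < next c | P c j) w j].
Proof.
move=> next_gt; pose N k := iter k next 0%N.
have ltN k : (N k < N k.+1)%N by rewrite /= next_gt.
have leN : {homo N : k l / (k <= l)%N}.
  by apply: (homo_leq leqnn leq_trans) => k; exact: ltnW.
have geN k : (k <= N k)%N by elim: k => // k IHk; exact: leq_ltn_trans (ltN k).
have exblk i : exists k, (i < N k.+1)%N by exists i; exact: leq_trans (geN _).
pose blk i := ex_minn (exblk i).
have blkP i : (N (blk i) <= i < N (blk i).+1)%N.
  rewrite /blk; case: ex_minnP => k ik mink; rewrite ik andbT leqNgt.
  apply/negP; case: k ik mink => // k ik mink lt_i.
  by have := mink k lt_i; rewrite ltnn.
have blk_eq i k : (N k <= i < N k.+1)%N -> blk i = k.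
  move=> /andP[ki ik]; have /andP[bi ib] := blkP i.
  apply/eqP; rewrite eqn_leq -ltnS -[(k <= _)%N]ltnS; apply/andP; split.
    by rewrite ltnNge; apply/negP => /leN /(leq_trans ik); rewrite ltnNge bi.
  by rewrite ltnNge; apply/negP => /leN /(leq_trans ib); rewrite ltnNge ki.
pose iot k := index_iota (N k) (N k.+1).
pose F k := [seq j <- iot k | P (N k) j].
pose L k := F k ++ [seq j <- iot k | predC (P (N k)) j].
have permL k : perm_eq (L k) (iot k) by rewrite /L perm_filterC.
have sizeL k : size (L k) = (N k.+1 - N k)%N.
  by rewrite (perm_size (permL k)) size_iota.
have uniqL k : uniq (L k) by rewrite (perm_uniq (permL k)) iota_uniq.
have memL k j : (j \in L k) = (N k <= j < N k.+1)%N.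
  by rewrite (perm_mem (permL k)) mem_index_iota.
(* [s] reads the reordered list of the block of [i]; [t], its inverse, looks up the position of an
   index in that list. *)
pose s i := nth 0%N (L (blk i)) (i - N (blk i)).
pose t i := (N (blk i) + index i (L (blk i)))%N.
have ltL i : (i - N (blk i) < size (L (blk i)))%N.
  by rewrite sizeL; have /andP[bi ib] := blkP i; rewrite ltn_sub2r// (leq_ltn_trans bi).
have blks i : blk (s i) = blk i by apply: blk_eq; rewrite -memL mem_nth.
have blkt i : blk (t i) = blk i.
  apply: blk_eq; rewrite leq_addr -ltn_subRL -sizeL index_mem memL; exact: blkP.
exists s.
  exists t => i; rewrite /s /t.
    rewrite -/(s i) blks index_uniq//.
    by rewrite subnKC//; have /andP[] := blkP i.
  rewrite -/(t i) blkt /t addKn nth_index// memL; exact: blkP.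
(* Block number n0 starts at [N n0] >= n0, far enough out. *)
move=> w n0; exists (N n0), (N n0 + size (F n0))%N, (N n0).
split; rewrite ?leq_addr ?geN//.
rewrite -[X in \sum_(X <= _ < _) w (s _)]add0n big_addn addKn.
transitivity (\sum_(j <- F n0) w j); last by rewrite big_filter.
rewrite [RHS](big_nth 0%N) big_nat [RHS]big_nat.
apply: eq_bigr => d /= ltd.
have -> : s (d + N n0)%N = nth 0%N (L n0) d.
  rewrite /s (blk_eq _ n0) ?addnK// leq_addl /= addnC -ltn_subRL -sizeL.
  by rewrite size_cat (leq_trans ltd)// leq_addr.
by rewrite nth_cat ltd.
Qed.

(** Unbounded subset sums would give, beyond every index, a finite subset sum of norm above 1. A
    rearrangement making these sums consecutive would not be Cauchy. *)
Lemma unconditional_subset_sums w : unconditionally_convergent w ->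
  exists M, forall (P : pred nat) n, L2_norm (\sum_(0 <= k < n | P k) w k) <= M.
Proof.
move=> uw; apply: contrapT => unb.
have tail N : exists t : nat * pred nat,
    (N < t.1)%N /\ 1 < L2_norm (\sum_(N <= k < t.1 | t.2 k) w k).
  pose c := \sum_(0 <= k < N) L2_norm (w k).
  have head n P : (n <= N)%N -> L2_norm (\sum_(0 <= k < n | P k) w k) <= c.
    move=> nN; rewrite (le_trans (le_L2_norm_sum _ _ _))//.
    rewrite /c (big_cat_nat _ nN)//= big_mkcond/= -[leLHS]addr0 lerD//.
      by apply: ler_sum => k _; case: ifP => // _; exact: L2_norm_ge0.
    by apply: sumr_ge0 => k _; exact: L2_norm_ge0.
  (* Any subset sum splits at N into a head of norm at most c and a tail, here assumed of norm at
     most 1. *)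
  apply: contrapT => notail; apply: unb; exists (c + 1) => P n.
  have [nN|Nn] := leqP n N; first by rewrite (le_trans (head _ _ nN))// lerDl.
  rewrite (big_cat_nat _ (ltnW Nn))//= (le_trans (L2_normD _ _))// lerD ?head//.
  by rewrite leNgt; apply/negP => lt1; apply: notail; exists (n, P).
have [t tP] := choice tail.
have [s bij_s sP] := block_rearrangement (fun n => (t n).2) (fun n => (tP n).1).
have /cvg_ex[/= l sl] := uw s bij_s.
have [n0 n0P] := L2_cvg_dist sl (e := 2^-1) ltac:(by rewrite invr_gt0).
have [a [b [c [n0a ab n0c ab_eq]]]] := sP w n0.
have : L2_norm (series (w \o s) b - series (w \o s) a) < 1.
  have -> : series (w \o s) b - series (w \o s) a =
      (l - series (w \o s) a) + (-1) *: (l - series (w \o s) b).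
    by rewrite scaleN1r opprB [RHS]addrC addrA subrK.
  rewrite (le_lt_trans (L2_normD _ _))// L2_normZ normcN normc1 mul1r.
  by rewrite [ltRHS]splitr mul1r ltrD// n0P// (leq_trans n0a).
rewrite sub_series_geq// ab_eq; apply/negP; rewrite -leNgt ltW//.
exact: (tP c).2.
Qed.

End SubsetSums.

(** * Norms in Gabor and wavelet systems *)

Section AffineInvariance.
Context {R : realType}.
Local Notation mu := (@lebesgue_measure R).

Definition affine (a b : R) : measurableTypeR R -> measurableTypeR R :=
  fun x => a * x + b.

Lemma measurable_affine (a b : R) :
  measurable_fun [set: measurableTypeR R] (affine a b).
Proof. by apply: measurable_funD => //; exact: measurable_funM. Qed.

(** The measure is a times the image of Lebesgue measure under the affine map; it is identified with
    Lebesgue measure next. *)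
Lemma affine_pushforwardE (a : {posnum R}) (b : R) :
  exists2 nu : {measure set (measurableTypeR R) -> \bar R},
    (forall A, nu A = (a%:num%:E * mu (affine a%:num b @^-1` A))%E) &
    forall f : R -> \bar R, measurable_fun [set: R] f -> (forall x, 0 <= f x)%E ->
    (\int[nu]_x f x = a%:num%:E * \int[mu]_x f (affine a%:num b x))%E.
Proof.
have mphi := measurable_affine a%:num b.
unshelve eexists (mscale (a%:num)%:nng (pushforward mu (affine a%:num b))).
- exact: mphi.
- by [].
- move=> f mf f0; rewrite ge0_integral_mscale//; congr (_ * _)%E.
  by rewrite ge0_integral_pushforward.
Qed.

(** Change of variables: the scaled image measure gives half-open intervals their length, so
    uniqueness of Lebesgue measure applies. *)
Lemma ge0_integral_affine (a : {posnum R}) (b : R) (f : R -> \bar R) :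
  measurable_fun [set: R] f -> (forall x, 0 <= f x)%E ->
  (\int[mu]_x f x = a%:num%:E * \int[mu]_x f (a%:num * x + b)%R)%E.
Proof.
move=> mf f0; have [nu nuE <-//] := affine_pushforwardE a b.
apply: eq_measure_integral => A mA _; apply: lebesgue_measure_unique => //.
move=> _ [[c d]] _ <-; rewrite nuE.
have -> : affine a%:num b @^-1` `]c, d] =
    `](c - b) / a%:num, (d - b) / a%:num]%classic.
  apply/seteqP; split => x /=; rewrite !in_itv/= /affine;
    by rewrite ltr_pdivrMr// ler_pdivlMr// ltrBlDr lerBrDr (mulrC x).
rewrite !lebesgue_measure_itv/= !lte_fin ltr_pM2r ?invr_gt0// ltrD2r.
case: ifP => _; last by rewrite mule0.
rewrite -!EFinB -EFinM -mulrBl mulrCA divff ?mulr1//.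
by congr EFin; lra.
Qed.

(** Only squared moduli are compared, so that modulations disappear; the factor a is the
    Jacobian. *)
Lemma L2_norm_affine (g u : L2 R) (a : {posnum R}) (b : R) :
  {ae mu, forall x, normc (u x) ^+ 2 = a%:num * normc (g (a%:num * x + b)) ^+ 2} ->
  L2_norm u = L2_norm g.
Proof.
move=> ug; apply/eqP; rewrite -(eqrXn2 (n := 2)) ?L2_norm_ge0//; apply/eqP/EFin_inj.
have msq (f : L2fun R) : measurable_fun [set: R] (fun x => (normc (f x) ^+ 2)%:E).
  by apply/measurable_EFinP; apply: measurable_funX; exact: measurable_normc_L2fun.
have mga : measurable_fun [set: R] (fun x => (normc (g (a%:num * x + b)) ^+ 2)%:E).
  exact: (measurableT_comp (msq g) (measurable_affine a%:num b)).
rewrite !L2_norm_sqrE (ge0_integral_affine a b (msq g)); last first.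
  by move=> x; rewrite lee_fin sqr_ge0.
rewrite -ge0_integralZl//; last by move=> x _; rewrite lee_fin sqr_ge0.
apply: ae_eq_integral; [by []|exact: msq|exact: measurable_funeM|].
by apply: (@filterS _ _ (ae_filter_ringOfSetsType mu)) ug => x -> _; rewrite EFinM.
Qed.

Lemma normc_expi (t : R) : normc (expi t) = 1.
Proof. by rewrite Defs.normcE /= cos2Dsin2 sqrtr1. Qed.

Lemma gabor_norm (g : L2 R) Phi n : is_gabor_system g Phi ->
  L2_norm (Phi n) = L2_norm g.
Proof.
move=> [a [b [a0 b0 [e _ eP]]]]; move: (eP n); case: (e n) => k l ae.
apply: (@L2_norm_affine _ _ 1%:pos (- (k%:~R * a))).
apply: (@filterS _ _ (ae_filter_ringOfSetsType mu)) ae => x ->.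
by rewrite normcM normc_expi !mul1r.
Qed.

Lemma wavelet_norm (g : L2 R) Phi n : is_wavelet_system g Phi ->
  L2_norm (Phi n) = L2_norm g.
Proof.
move=> [a [b [a1 b0 [e _ eP]]]]; move: (eP n); case: (e n) => j k ae.
have a0 : 0 < a by exact: lt_trans a1.
have aj : 0 < a ^ j by rewrite exprz_gt0.
apply: (@L2_norm_affine _ _ (PosNum aj) (- (k%:~R * b))).
apply: (@filterS _ _ (ae_filter_ringOfSetsType mu)) ae => x ->.
rewrite normcM normcC ger0_norm ?powR_ge0// exprMn; congr (_ * _).
(* The square of the normalizing factor a^(j/2) is exactly the Jacobian a^j. *)
by rewrite -powR_mulrn ?powR_ge0// -powRrM divfK ?pnatr_eq0// powR_intmul// ltW.
Qed.

End AffineInvariance.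

(** * Bessel bounds *)

Section Bessel.
Context {R : realType}.
Implicit Types (f h u : L2 R) (Phi Psi y : nat -> L2 R) (a m : nat -> R[i]).

Lemma L2_norm_sqr_Re u : L2_norm u ^+ 2 = complex.Re (L2_dot u u).
Proof. by rewrite L2_dotuu. Qed.

Lemma L2_normN u : L2_norm (- u) = L2_norm u.
Proof. by rewrite -scaleN1r L2_normZ normcN normc1 mul1r. Qed.

Lemma L2_dotNr u v : L2_dot u (- v) = - L2_dot u v :> R[i].
Proof. by rewrite -scaleN1r L2_dotZr rmorphN rmorph1 mulN1r. Qed.

Lemma L2_dotNl u v : L2_dot (- u) v = - L2_dot u v :> R[i].
Proof. by rewrite -scaleN1r L2_dotZl mulN1r. Qed.

Lemma L2_dot_sumr (I : Type) (r : seq I) (P : pred I) (F : I -> L2 R) u :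
  L2_dot u (\sum_(i <- r | P i) F i) = \sum_(i <- r | P i) L2_dot u (F i).
Proof.
elim/big_rec2: _ => [|i y x _ <-]; last by rewrite L2_dotDr.
by rewrite -[X in L2_dot _ X](scale0r (0 : L2 R)) L2_dotZr conjc0 mul0r.
Qed.

Definition flip (e : pred nat) y k : L2 R := if e k then y k else - y k.

(** By induction: the sign of each new vector is chosen to make its real inner product with the sum
    so far nonnegative. *)
Lemma exists_flip y n : exists e : pred nat,
  \sum_(0 <= k < n) L2_norm (y k) ^+ 2 <=
  L2_norm (\sum_(0 <= k < n) flip e y k) ^+ 2.
Proof.
elim: n => [|n [e le_e]].
  by exists xpred0; rewrite !big_geq// L2_norm0 expr0n.
set S := \sum_(0 <= k < n) flip e y k in le_e.
pose e' k := if k == n then 0 <= complex.Re (L2_dot S (y n)) else e k.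
exists e'; rewrite !big_nat_recr//=.
have -> : \sum_(0 <= k < n) flip e' y k = S.
  by apply: eq_big_nat => k /andP[_ kn]; rewrite /flip /e' lt_eqF.
rewrite L2_norm_sqrD /flip /e' eqxx; case: ifPn => [re0|].
  by rewrite -[leLHS]addr0 lerD// ?lerD2r// mulr_ge0.
rewrite -ltNge L2_normN L2_dotNr => re0; rewrite -[leLHS]addr0 lerD ?lerD2r//.
by rewrite mulr_ge0//; case: (L2_dot S (y n)) re0 => x z /=; rewrite oppr_ge0 => /ltW.
Qed.

(** A signed sum is the difference of two subset sums, whence the factor 2. *)
Lemma flip_sum_norm (e : pred nat) y n c :
  (forall P : pred nat, L2_norm (\sum_(0 <= k < n | P k) y k) <= c) ->
  L2_norm (\sum_(0 <= k < n) flip e y k) <= 2 * c.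
Proof.
move=> yc; rewrite (bigID e)/=.
rewrite (eq_bigr y); last by move=> k ek; rewrite /flip ek.
rewrite [X in _ + X](eq_bigr (fun k => - y k)); last first.
  by move=> k /negPf ek; rewrite /flip ek.
rewrite sumrN (le_trans (L2_normD _ _))// L2_normN mulrDl mul1r.
by rewrite lerD// yc.
Qed.

(** * Square-sum estimates from a uniform bound on partial multipliers *)

Section MultiplierBounds.
Variables (m : nat -> R[i]) (Phi Psi : nat -> L2 R) (C : R).
Hypothesis MC : forall (P : pred nat) n f,
  L2_norm (\sum_(0 <= k < n | P k) multiplier_term m Phi Psi f k) <= C * L2_norm f.

Lemma multiplier_analysis_bound f n :
  \sum_(0 <= k < n) (normc (m k) * normc (L2_dot f (Psi k)) * L2_norm (Phi k)) ^+ 2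
    <= (2 * C * L2_norm f) ^+ 2.
Proof.
have [e le_e] := exists_flip (multiplier_term m Phi Psi f) n.
under eq_bigr do rewrite -normcM -L2_normZ; apply: (le_trans le_e).
have le_c : L2_norm (\sum_(0 <= k < n) flip e (multiplier_term m Phi Psi f) k)
    <= 2 * C * L2_norm f by rewrite -mulrA; apply: flip_sum_norm => P; exact: MC.
by rewrite ler_pXn2r ?nnegrE ?L2_norm_ge0// (le_trans (L2_norm_ge0 _) le_c).
Qed.

(* The flipped adjoint [u] satisfies [<u, u> = <h, M_e u>]. *)
Lemma multiplier_synthesis_bound h n :
  \sum_(0 <= k < n) (normc (m k) * normc (L2_dot h (Phi k)) * L2_norm (Psi k)) ^+ 2
    <= (2 * C * L2_norm h) ^+ 2.
Proof.
(* These are the terms of the adjoint multiplier applied to [h]. *)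
pose x k := (conjc (m k) * L2_dot h (Phi k)) *: Psi k.
have [e] := exists_flip x n; set u := \sum_(0 <= k < n) flip _ _ _ => le_e.
under eq_bigr do rewrite -(normc_conjc (m _)) -normcM -L2_normZ.
apply: (le_trans le_e).
pose Mu := \sum_(0 <= k < n) flip e (multiplier_term m Phi Psi u) k.
have uMu : L2_dot u u = L2_dot h Mu.
  rewrite {1}/u L2_dot_suml L2_dot_sumr; apply: eq_bigr => k _.
  have xk : L2_dot (x k) u = L2_dot h (multiplier_term m Phi Psi u k).
    rewrite L2_dotZl L2_dotZr (L2_dotC (Psi k)) mulrAC; congr (_ * _).
    exact/esym/rmorphM.
  by rewrite /flip; case: (e k); rewrite ?L2_dotNl ?L2_dotNr xk.
have Mu_le : L2_norm Mu <= 2 * (C * L2_norm u).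
  by apply: flip_sum_norm => P; exact: MC.
have le_u : L2_norm u ^+ 2 <= L2_norm h * (2 * (C * L2_norm u)).
  rewrite L2_norm_sqr_Re uMu (le_trans (ler_norm _))//.
  rewrite (le_trans (le_Re_normc _))// (le_trans (L2_CauchySchwarz _ _))//.
  by rewrite ler_wpM2l// L2_norm_ge0.
have C0 : 0 <= 2 * C * L2_norm h.
  rewrite -mulrA mulr_ge0// (le_trans _ (MC xpred0 0%N h))// L2_norm_ge0//.
have [->|u0] := eqVneq (L2_norm u) 0; first by rewrite expr0n/= sqr_ge0.
have u_gt0 : 0 < L2_norm u by rewrite lt_neqAle eq_sym u0 L2_norm_ge0.
rewrite ler_pXn2r ?nnegrE ?L2_norm_ge0// -(ler_pM2r u_gt0) -expr2 (le_trans le_u)//.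
by rewrite le_eqVlt; apply/orP; left; apply/eqP; ring.
Qed.

End MultiplierBounds.

(** * Finite synthesis sums and frame inequalities *)

Lemma dot_synthesis_le a y h n t : 0 < t ->
  2 * normc (L2_dot (\sum_(0 <= k < n) a k *: y k) h) <=
  t * \sum_(0 <= k < n) normc (a k) ^+ 2 +
  t^-1 * \sum_(0 <= k < n) normc (L2_dot h (y k)) ^+ 2.
Proof.
move=> t0; rewrite L2_dot_suml !mulr_sumr -big_split/=.
rewrite (@le_trans _ _ (2 * \sum_(0 <= k < n) normc (L2_dot (a k *: y k) h)))//.
  by rewrite ler_pM2l// le_normc_sum.
rewrite mulr_sumr; apply: ler_sum => k _.
rewrite L2_dotZl normcM [L2_dot (y k) h]L2_dotC normc_conjc.
set p := normc (a k); set q := normc _.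
have : 0 <= t^-1 * (t * p - q) ^+ 2 by rewrite mulr_ge0 ?sqr_ge0// invr_ge0 ltW.
have -> : t^-1 * (t * p - q) ^+ 2 = t * p ^+ 2 + t^-1 * q ^+ 2 - 2 * (p * q).
  by field; rewrite gt_eqF.
by rewrite subr_ge0.
Qed.

(** With [h] equal to the sum S and t = B, [dot_synthesis_le] and the Bessel bound give 2|S|^2 <= B
    sum |a_k|^2 + |S|^2. *)
Lemma synthesis_le a y n B : 0 < B ->
  (forall h, \sum_(0 <= k < n) normc (L2_dot h (y k)) ^+ 2 <= B * L2_norm h ^+ 2) ->
  L2_norm (\sum_(0 <= k < n) a k *: y k) ^+ 2 <=
  B * \sum_(0 <= k < n) normc (a k) ^+ 2.
Proof.
move=> B0 yB; set S := \sum_(0 <= k < n) a k *: y k.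
have := dot_synthesis_le a y S n B0; rewrite -/S => le2.
have /(ler_wpM2l (ltW (_ : 0 < B^-1))) := yB S; rewrite invr_gt0 => /(_ B0).
rewrite mulKf ?gt_eqF// => le1.
have : L2_norm S ^+ 2 <= normc (L2_dot S S).
  by rewrite L2_norm_sqr_Re (le_trans (ler_norm _))// le_Re_normc.
by lra.
Qed.

Lemma nneseries_le (b : nat -> R) c : (forall k, 0 <= b k) ->
  (forall n, \sum_(0 <= k < n) b k <= c) ->
  (\sum_(k <oo) (b k)%:E <= c%:E)%E.
Proof.
move=> b0 bc; apply: lime_le.
  by apply: is_cvg_nneseries => k _ _; rewrite lee_fin.
by apply: nearW => n; rewrite sumEFin lee_fin.
Qed.

(** Testing against real majorants of the partial sums suffices, since an infinite sum satisfies any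
    lower bound. *)
Lemma nneseries_ge (b : nat -> R) c : (forall k, 0 <= b k) ->
  (forall s, (forall n, \sum_(0 <= k < n) b k <= s) -> c <= s) ->
  (c%:E <= \sum_(k <oo) (b k)%:E)%E.
Proof.
move=> b0 bc; set S := (\sum_(k <oo) _)%E.
have bS n : ((\sum_(0 <= k < n) b k)%:E <= S)%E.
  rewrite -sumEFin; apply: nneseries_lim_ge => k _ _.
  by rewrite lee_fin.
case: S bS => [s| |] bS; [|by rewrite leey|by have := bS 0%N].
by rewrite lee_fin; apply: bc => n; rewrite -lee_fin.
Qed.

Lemma frame_intro y A B : 0 < A ->
  (forall h s, (forall n, \sum_(0 <= k < n) normc (L2_dot h (y k)) ^+ 2 <= s) ->
    A * L2_norm h ^+ 2 <= s) ->
  (forall h n, \sum_(0 <= k < n) normc (L2_dot h (y k)) ^+ 2 <= B * L2_norm h ^+ 2) ->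
  is_frame y.
Proof.
(* The maximum secures the order A <= B required by [is_frame]. *)
move=> A0 lowA upB; exists A, (Num.max A B); split => //; first by rewrite le_max lexx.
move=> h; split.
  by apply: nneseries_ge => [k|s]; [exact: sqr_ge0|exact: lowA].
apply: nneseries_le => [k|n]; first exact: sqr_ge0.
by rewrite (le_trans (upB h n))// ler_wpM2r ?sqr_ge0// le_max lexx orbT.
Qed.

End Bessel.

(** * Frames from an invertible multiplier *)

Section FramesFromMultiplier.
Context {R : realType}.
Implicit Types (f h : L2 R).
Variables (m : nat -> R[i]) (Phi Psi : nat -> L2 R).
Hypothesis mcv : multiplier_unconditionally_convergent m Phi Psi.

Local Notation M := (multiplier m Phi Psi).
Local Notation mterm := (multiplier_term m Phi Psi).

(** The seminorms are indexed by a subset and a cutoff. Each is a finite sum of rank-one terms,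
    bounded by Cauchy-Schwarz, and [unconditional_subset_sums] bounds the family pointwise. *)
Lemma multiplier_uniform_bound : exists2 C, 0 < C &
  forall (P : pred nat) n f,
    L2_norm (\sum_(0 <= k < n | P k) mterm f k) <= C * L2_norm f.
Proof.
pose p (i : pred nat * nat) f := L2_norm (\sum_(0 <= k < i.2 | i.1 k) mterm f k).
have [||||C C0 pC] := @uniform_boundedness R _ p.
- move=> [P n] f g; rewrite /p/= (le_trans _ (L2_normD _ _))// -big_split/=.
  rewrite le_eqVlt; apply/orP; left; apply/eqP; congr L2_norm.
  by apply: eq_bigr => k _; rewrite /multiplier_term L2_dotDl mulrDr scalerDl.
- move=> [P n] a f; rewrite /p/= -L2_normZ scaler_sumr; congr L2_norm.
  by apply: eq_bigr => k _; rewrite /multiplier_term L2_dotZl scalerA mulrCA.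
- move=> [P n].
  exists (\sum_(0 <= k < n | P k) normc (m k) * L2_norm (Psi k) * L2_norm (Phi k)).
  move=> f; rewrite (le_trans (le_L2_norm_sum _ _ _))// mulr_suml.
  apply: ler_sum => k _; rewrite L2_normZ normcM.
  rewrite [leRHS]mulrAC ler_wpM2r ?L2_norm_ge0// -mulrA ler_wpM2l ?normc_ge0//.
  by rewrite mulrC L2_CauchySchwarz.
- move=> f; have [c fc] := unconditional_subset_sums (@mcv f).
  by exists c => -[P n]; exact: fc.
by exists C => // P n f; exact: (pC (P, n)).
Qed.

(** The identity permutation gives convergence in the given order; the scalars are regrouped to
    display a synthesis sum of the vectors m_k phi_k. *)
Lemma multiplier_approx f e : 0 < e -> exists n,
  L2_norm (M f - \sum_(0 <= k < n) L2_dot f (Psi k) *: (m k *: Phi k)) < e.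
Proof.
move=> e0; have cvgf := @mcv f id (Bijective (frefl id) (frefl id)).
have [n /(_ n (leqnn n)) ltn] := L2_cvg_dist cvgf e0.
exists n; move: ltn; rewrite /series/=.
by under eq_bigr do rewrite /multiplier_term mulrC -scalerA.
Qed.

Variables (Bphi Bpsi K : R) (T : L2 R -> L2 R).
Hypotheses (Bphi0 : 0 < Bphi) (Bpsi0 : 0 < Bpsi) (K0 : 0 < K).
Hypothesis besselPhi : forall h n,
  \sum_(0 <= k < n) normc (L2_dot h (m k *: Phi k)) ^+ 2 <= Bphi * L2_norm h ^+ 2.
Hypothesis besselPsi : forall h n,
  \sum_(0 <= k < n) normc (L2_dot h (Psi k)) ^+ 2 <= Bpsi * L2_norm h ^+ 2.
Hypothesis TK : forall f, L2_norm (T f) <= K * L2_norm f.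
Hypothesis MT : forall f, M (T f) = f.
Hypothesis TM : forall f, T (M f) = f.

(** From f = T (M f) one has |f| <= K |M f|, while M f is a limit of synthesis sums with
    coefficients <f, psi_k>, so |M f|^2 <= [Bphi] s. *)
Lemma lower_frame_Psi f s :
  (forall n, \sum_(0 <= k < n) normc (L2_dot f (Psi k)) ^+ 2 <= s) ->
  (K ^+ 2 * Bphi)^-1 * L2_norm f ^+ 2 <= s.
Proof.
move=> fs.
have s0 : 0 <= s by have := fs 0%N; rewrite big_geq.
have Mf : L2_norm (M f) <= Num.sqrt (Bphi * s).
  apply/ler_addgt0Pr => e e0; have [n ltn] := multiplier_approx f e0.
  set S := \sum_(0 <= k < n) _ in ltn.
  have -> : M f = (M f - S) + S by rewrite subrK.
  rewrite (le_trans (L2_normD _ _))// addrC lerD ?(ltW ltn)//.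
  rewrite -[leLHS]ger0_norm ?L2_norm_ge0// -sqrtr_sqr ler_wsqrtr//.
  by rewrite (le_trans (synthesis_le _ Bphi0 (besselPhi^~ n)))// ler_wpM2l// ltW.
rewrite ler_pdivrMl ?mulr_gt0 ?exprn_gt0// -mulrA -[Bphi * s]sqr_sqrtr; last first.
  by rewrite mulr_ge0// ltW.
rewrite -exprMn ler_pXn2r ?nnegrE ?L2_norm_ge0//; last first.
  by rewrite mulr_ge0 ?sqrtr_ge0// ltW.
by rewrite -{1}[f]TM (le_trans (TK _))// ler_pM2l.
Qed.

(** From h = M (T h), |h|^2 is approximated by the inner product with h of a synthesis sum S with
    coefficients <T h, psi_k>. The weighted inequality then bounds 2|h|^2 by |h|^2 + c s + e. *)
Lemma lower_frame_Phi h s :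
  (forall n, \sum_(0 <= k < n) normc (L2_dot h (m k *: Phi k)) ^+ 2 <= s) ->
  (K ^+ 2 * Bpsi)^-1 * L2_norm h ^+ 2 <= s.
Proof.
move=> hs; set c := K ^+ 2 * Bpsi.
have c0 : 0 < c by rewrite mulr_gt0// exprn_gt0.
rewrite ler_pdivrMl//; apply/ler_addgt0Pr => e e0.
set x := L2_norm h; have x0 : 0 <= x := L2_norm_ge0 h.
(* Makes the error 2 |h - S| x at most e; x + 1 keeps the denominator positive when h = 0. *)
have e0' : 0 < e / (2 * (x + 1)).
  by rewrite divr_gt0// mulr_gt0// ltr_wpDl.
have [n] := multiplier_approx (T h) e0'; rewrite MT.
set S := \sum_(0 <= k < n) _ => ltn.
have hS : x ^+ 2 <= L2_norm (h - S) * x + normc (L2_dot S h).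
  have -> : x ^+ 2 = complex.Re (L2_dot (h - S) h + L2_dot S h).
    by rewrite -L2_dotDl subrK -L2_norm_sqr_Re.
  rewrite ReD; apply: lerD; rewrite (le_trans (ler_norm _))//.
    by rewrite (le_trans (le_Re_normc _))// L2_CauchySchwarz.
  exact: le_Re_normc.
have cx : c^-1 * \sum_(0 <= k < n) normc (L2_dot (T h) (Psi k)) ^+ 2 <= x ^+ 2.
  rewrite ler_pdivrMl// (le_trans (besselPsi _ _))//.
  have -> : c * x ^+ 2 = Bpsi * (K * x) ^+ 2 by rewrite /c; ring.
  have Kx : 0 <= K * x by rewrite mulr_ge0// ltW.
  by rewrite ler_pM2l// ler_pXn2r ?nnegrE ?L2_norm_ge0 ?Kx// TK.
(* The weight t = c^-1 makes the coefficient term at most |h|^2, by [cx]. *)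
have := dot_synthesis_le (fun k => L2_dot (T h) (Psi k))
  (fun k => m k *: Phi k) h n (t := c^-1).
rewrite invr_gt0 invrK -/S => /(_ c0) le2.
have cs : c * \sum_(0 <= k < n) normc (L2_dot h (m k *: Phi k)) ^+ 2 <= c * s.
  by rewrite ler_pM2l.
have ex : 2 * (L2_norm (h - S) * x) <= e.
  rewrite (@le_trans _ _ (2 * (e / (2 * (x + 1)) * (x + 1))))//.
    rewrite ler_pM2l// ler_pM ?L2_norm_ge0 ?(ltW ltn)// lerDl//.
  by rewrite le_eqVlt; apply/orP; left; apply/eqP; field; rewrite gt_eqF// ltr_wpDl.
by lra.
Qed.

End FramesFromMultiplier.

Theorem corollary4p5 (R : realType) (gPhi gPsi : L2 R)
    (Phi Psi : nat -> L2 R) (m : nat -> R[i]) :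
  gPhi != 0 -> gPsi != 0 ->
  (is_gabor_system gPhi Phi /\ is_gabor_system gPsi Psi) \/
  (is_wavelet_system gPhi Phi /\ is_wavelet_system gPsi Psi) ->
  norm_bounded_below m ->
  multiplier_unconditionally_convergent m Phi Psi ->
  invertible_operator (multiplier m Phi Psi) ->
  exists c d : nat -> R[i],
    [/\ forall n, m n = c n * conjc (d n),
        is_frame (fun n => c n *: Phi n) &
        is_frame (fun n => d n *: Psi n)].
Proof.
move=> gPhi0 gPsi0 sys mnbb mcv [T [[K TK] MT TM]].
have norm_gt0 (g : L2 R) : g != 0 -> 0 < L2_norm g.
  move=> g0; rewrite lt_neqAle L2_norm_ge0 andbT eq_sym; apply/eqP => /L2_norm_eq0 gE.
  by rewrite gE eqxx in g0.
have p0 := norm_gt0 _ gPhi0; have q0 := norm_gt0 _ gPsi0.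
have normPhi n : L2_norm (Phi n) = L2_norm gPhi.
  by case: sys => -[sPhi _]; [exact: gabor_norm|exact: wavelet_norm].
have normPsi n : L2_norm (Psi n) = L2_norm gPsi.
  by case: sys => -[_ sPsi]; [exact: gabor_norm|exact: wavelet_norm].
move: mnbb; rewrite /norm_bounded_below; set delta := inf _ => delta0.
have delta_le n : delta <= normc (m n).
  apply: ge_inf; last by exists n.
  by exists 0 => _ [k _ <-]; exact: normc_ge0.
have [C C0 MC] := multiplier_uniform_bound mcv.
(* The operator bound is made strictly positive, since the lower frame bounds divide by its
   square. *)
have TK' f : L2_norm (T f) <= (`|K| + 1) * L2_norm f.
  rewrite (le_trans (TK f))// ler_wpM2r ?L2_norm_ge0//.
  by rewrite (le_trans (ler_norm _))// lerDl.
have K0 : 0 < `|K| + 1 by rewrite ltr_wpDl.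
(* The synthesis estimate carries the factor |psi_k| = |gPsi|; the analysis estimate carries |m_k|
   |phi_k| >= delta |gPhi|. Dividing by these gives the two Bessel constants. *)
pose Bphi := (2 * C / L2_norm gPsi) ^+ 2.
pose Bpsi := (2 * C / (delta * L2_norm gPhi)) ^+ 2.
have Bphi0 : 0 < Bphi by rewrite exprn_gt0// divr_gt0// mulr_gt0.
have Bpsi0 : 0 < Bpsi by rewrite exprn_gt0// divr_gt0// mulr_gt0.
have besselPhi h n :
    \sum_(0 <= k < n) normc (L2_dot h (m k *: Phi k)) ^+ 2 <= Bphi * L2_norm h ^+ 2.
  have := multiplier_synthesis_bound MC h n.
  under eq_bigr do rewrite normPsi exprMn -[normc (m _)]normc_conjc -normcM -L2_dotZr.
  by rewrite -mulr_suml -ler_pdivlMr ?exprn_gt0// -expr_div_n mulrAC exprMn.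
have besselPsi f n :
    \sum_(0 <= k < n) normc (L2_dot f (Psi k)) ^+ 2 <= Bpsi * L2_norm f ^+ 2.
  rewrite -exprMn mulrAC expr_div_n ler_pdivlMr ?exprn_gt0 ?mulr_gt0//.
  apply: le_trans (multiplier_analysis_bound MC f n).
  rewrite mulr_suml; apply: ler_sum => k _; rewrite normPhi -exprMn mulrCA mulrA.
  rewrite ler_pXn2r ?nnegrE ?mulr_ge0 ?normc_ge0 ?L2_norm_ge0// ?(ltW delta0)//.
  by rewrite ler_wpM2r ?L2_norm_ge0// ler_wpM2r ?normc_ge0.
exists m, (fun=> 1); split.
- by move=> n; rewrite conjc1 mulr1.
- apply: (frame_intro (A := ((`|K| + 1) ^+ 2 * Bpsi)^-1)) besselPhi.
    by rewrite invr_gt0 mulr_gt0// exprn_gt0.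
  by move=> h s; apply: (lower_frame_Phi mcv Bpsi0 K0 besselPsi TK' MT).
- under eq_fun do rewrite scale1r.
  apply: (frame_intro (A := ((`|K| + 1) ^+ 2 * Bphi)^-1)) besselPsi.
    by rewrite invr_gt0 mulr_gt0// exprn_gt0.
  by move=> h s; apply: (lower_frame_Psi mcv Bphi0 K0 besselPhi TK' TM).
Qed.
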